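(* Let $n\ge1$ and $d\ge2$ be integers and $n_1=n/\gcd(n,d)$. Then $d\,\Sigma(n,d)\cong\Sigma(n_1,d)$ and $d\,S(n,d)\cong S(n_1,d)$, where $dG=\{dg: g\in G\}$.
   Context: For $N\ge1$: in $\mathbb{Q}[x]/(x^N-1)$ (exponents mod $N$) put $e_v=x^v-1$, $\epsilon_v=d\,e_v-e_{dv}$; $\mathcal Z_N$ = $\mathbb{Z}$-span of $e_1,\dots,e_{N-1}$, $\mathcal E_{N,d}$ = $\mathbb{Z}$-span of $\epsilon_1,\dots,\epsilon_{N-1}$, $\Sigma(N,d)=\mathcal Z_N/\mathcal E_{N,d}$. With $f_v=dx^v-\sum_{i=0}^{d-1}x^{dv+i}$, $S(N,d)=\mathcal Z_N/\langle f_1,\dots,f_{N-1}\rangle_{\mathbb{Z}}$ (the sandpile group of the generalized de Bruijn graph on $\mathbb{Z}_N$ with arcs $v\to dv+i$, $0\le i\le d-1$), viewed as a subgroup of $\Sigma(N,d)$ via the injection induced by $c\mapsto(x-1)c$. *)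

(* Defs.v *)
From HB Require Import structures.
From mathcomp Require Import all_boot all_order all_algebra.
From mathcomp Require Import qpoly.
From mathcomp Require Import boolp.

Set Implicit Arguments.
Unset Strict Implicit.
Unset Printing Implicit Defensive.

Import GRing.Theory Pdiv.CommonRing Pdiv.RingMonic.
Local Open Scope ring_scope.

Section Subgroups.
Variables (V : zmodType) (A : zmodClosed V).

Record subgroup := Subgroup { subgroup_val : V; _ : subgroup_val \in A }.

HB.instance Definition _ := [isSub for subgroup_val].
HB.instance Definition _ := [Choice of subgroup by <:].
HB.instance Definition _ := [SubChoice_isSubZmodule of subgroup by <:].

Variable B : zmodClosed V.

Definition trace_pred : {pred subgroup} := [pred a | val a \in B].

Fact trace_closed : zmod_closed trace_pred.
Proof.
by split=> [|a b]; rewrite !inE ?raddf0 ?rpred0 // raddfB; apply: rpredB.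
Qed.

HB.instance Definition _ :=
  GRing.isZmodClosed.Build subgroup trace_pred trace_closed.

(* A / (A :&: B), i.e. A / B when B is contained in A; the containments needed *)
(* for Sigma and Sandpile (N > 0) are calE_sub_calZ and calF_sub_calZ.         *)
Definition subquotient : zmodType := Quotient.quot trace_pred.

End Subgroups.

Section Spans.
Variables (V : zmodType) (m : nat) (s : m.-tuple V).

Definition Zspan : {pred V} := [pred v | `[< inIntSpan s v >]].

Fact Zspan_closed : zmod_closed Zspan.
Proof.
split=> [|u v]; rewrite !inE.
  apply/asboolP; exists [ffun=> 0]; rewrite big1 // => i _.
  by rewrite ffunE mulr0z.
move=> /asboolP[a ->] /asboolP[b ->]; apply/asboolP.
exists [ffun i => a i - b i]; rewrite -sumrB; apply: eq_bigr => i _.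
by rewrite ffunE mulrzBr.
Qed.

HB.instance Definition _ := GRing.isZmodClosed.Build V Zspan Zspan_closed.

Lemma mem_Zspan v : v \in (s : seq V) -> v \in Zspan.
Proof.
case/tnthP=> i ->; rewrite inE; apply/asboolP.
exists [ffun j => (j == i)%:R]; rewrite (bigD1 i) //= ffunE eqxx mulr1z.
rewrite (tnth_nth 0) big1 ?addr0 // => j /negPf ji.
by rewrite ffunE ji mulr0z.
Qed.

End Spans.

Section Multiples.
Variables (d : nat) (G : zmodType).

Definition multiples_pred : {pred G} :=
  [pred g | `[< exists h : G, g = h *+ d >]].

Fact multiples_closed : zmod_closed multiples_pred.
Proof.
split=> [|u v]; rewrite !inE; first by apply/asboolP; exists 0; rewrite mul0rn.
move=> /asboolP[a ->] /asboolP[b ->]; apply/asboolP.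
by exists (a - b); rewrite mulrnBl.
Qed.

HB.instance Definition _ :=
  GRing.isZmodClosed.Build G multiples_pred multiples_closed.

Definition multiples : zmodType := subgroup multiples_pred.

End Multiples.

Definition isomorphic (U V : zmodType) : Prop :=
  exists f : {additive U -> V}, bijective f.

(* Meaningful for N > 0 only: a null modulus is replaced by 'X in qpoly. *)
Definition cyclic_algebra (N : nat) : comNzRingType :=
  {poly %/ ('X^N - 1 : {poly rat})}.

Section Generators.
Variables (N d : nat).

Definition xgen : cyclic_algebra N := 'qX.

Definition e_ (v : nat) : cyclic_algebra N := xgen ^+ v - 1.

Definition eps (v : nat) : cyclic_algebra N := d%:R * e_ v - e_ (d * v).

Definition f_ (v : nat) : cyclic_algebra N :=
  d%:R * xgen ^+ v - \sum_(0 <= i < d) xgen ^+ (d * v + i).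

Definition calZ : {pred cyclic_algebra N} :=
  Zspan [tuple e_ i.+1 | i < N.-1].

Definition calE : {pred cyclic_algebra N} :=
  Zspan [tuple eps i.+1 | i < N.-1].

Definition calF : {pred cyclic_algebra N} :=
  Zspan [tuple f_ i.+1 | i < N.-1].

HB.instance Definition _ := GRing.ZmodClosed.on calZ.
HB.instance Definition _ := GRing.ZmodClosed.on calE.
HB.instance Definition _ := GRing.ZmodClosed.on calF.

Definition Sigma : zmodType := subquotient calZ calE.

Definition Sandpile : zmodType := subquotient calZ calF.

End Generators.

Arguments calZ : clear implicits.
Arguments calE : clear implicits.
Arguments calF : clear implicits.

Section Containment.
Variables (N d : nat).
Hypothesis N_gt0 : (0 < N)%N.

Lemma xgen_exprN : xgen N ^+ N = 1.
Proof.
rewrite /xgen /qpolyX -rmorphXn /=; apply/val_inj => /=.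
have mN : mk_monic ('X^N - 1 : {poly rat}) = 'X^N - 1.
  by rewrite /mk_monic size_XnsubC // ltnS N_gt0 monicXnsubC.
rewrite mN -[X in rmodp X _](subrK 1) rmodpD ?monicXnsubC //.
rewrite rmodpp ?monicXnsubC // add0r rmodp_small //.
by rewrite size_XnsubC // size_poly1 ltnS.
Qed.

Lemma xgen_modn v : xgen N ^+ v = xgen N ^+ (v %% N).
Proof.
by rewrite {1}(divn_eq v N) exprD mulnC exprM xgen_exprN expr1n mul1r.
Qed.

Lemma e_in_calZ v : e_ N v \in calZ N.
Proof.
rewrite /e_ xgen_modn; case E: (v %% N)%N => [|r].
  by rewrite expr0 subrr rpred0.
have lt_r : (r < N.-1)%N by rewrite -ltnS prednK // -E ltn_pmod.
apply: mem_Zspan; apply/tnthP; exists (Ordinal lt_r).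
by rewrite tnth_mktuple.
Qed.

Lemma calE_sub_calZ : {subset calE N d <= calZ N}.
Proof.
move=> z; rewrite inE => /asboolP[a ->]; apply: rpred_sum => i _.
apply: rpredMz; rewrite -tnth_nth tnth_mktuple.
by rewrite /eps mulr_natl rpredB ?rpredMn ?e_in_calZ.
Qed.

Lemma calF_sub_calZ : {subset calF N d <= calZ N}.
Proof.
move=> z; rewrite inE => /asboolP[a ->]; apply: rpred_sum => i _.
apply: rpredMz; rewrite -tnth_nth tnth_mktuple.
have -> : f_ N d i.+1
    = d%:R * e_ N i.+1 - \sum_(0 <= j < d) e_ N (d * i.+1 + j).
  rewrite /f_ /e_ sumrB sumr_const_nat subn0 mulrBr mulr1 opprB addrA.
  by rewrite subrK.
by rewrite mulr_natl rpredB ?rpredMn ?rpred_sum // => *; apply: e_in_calZ.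
Qed.

End Containment.

(* Main.v *)
From HB Require Import structures.
Require Import Defs.
From mathcomp Require Import all_boot all_order all_algebra.
From mathcomp Require Import qpoly boolp zify.

Set Implicit Arguments.
Unset Strict Implicit.
Unset Printing Implicit Defensive.

Import GRing.Theory Num.Theory.

(* Let phi be the endomorphism x^v |-> x^(dv) of the cyclic algebra, and phi' *)
(* the endomorphism x^v |-> x^(dv) + ... + x^(dv+d-1). Then Sigma(n,d) is     *)
(* calZ / (d - phi) calZ, and, since f_0 + ... + f_(n-1) = 0, S(n,d) is calZ  *)
(* / (d - phi') Z[x]/(x^n - 1). On these quotients d acts as phi, resp. phi'. *)
(* With g = gcd(n,d), the map phi factors through psi : y^v |-> x^(gv) from   *)
(* Q[y]/(y^n1 - 1), which is injective, has saturated image, and intertwines  *)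
(* the versions of phi for n1 and n; hence psi induces an isomorphism from    *)
(* Sigma(n1,d) onto d Sigma(n,d). For S(n,d) the same argument works with     *)
(* phi' and psi' : y^v |-> x^(gv) + ... + x^(gv+g-1), which is what psi       *)
(* becomes under the embedding c |-> (x-1) c of S into Sigma.                 *)

(** Since [d] acts as phi on each quotient Q = A/B, the group dQ is the image of phi(A). The
    factorization of phi as psi after sigma puts phi(A) inside psi(A1), and a Bezout relation d k =
    g + n t puts psi(A1) inside phi(A). So dQ is the image of psi(A1), and what remains is that psi
    a lies in B exactly when a lies in B1. This is settled in [multiples_coker_isomorphic]: psi a =
    d m - phi m reads d m = psi (a + sigma m), saturation then puts m in the image of psi, and the
    relation descends to n1. [calE_coker] and [calF_coker] present the relation groups as images of
    d - phi, and [block_sub_add_mul] makes the Bezout step work for S. *)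

Section MultiplesOfSubquotients.
Local Open Scope ring_scope.
Local Open Scope quotient_scope.

(** * Criteria for the multiples of a subquotient *)

Lemma inj_surj_bijective (T U : Type) (f : T -> U) :
  injective f -> (forall y, exists x, f x = y) -> bijective f.
Proof.
move=> f_inj f_surj; exists (fun y => sval (cid (f_surj y))) => [x|y].
  by apply: f_inj; case: cid.
by case: cid.
Qed.

(** Both groups are [U] modulo the common kernel of [p] and [j]. The map is [p] of a chosen
    [j]-preimage; equality of the kernels makes the choice harmless. *)
Lemma multiples_isomorphic (d : nat) (U Q Q1 : zmodType)
    (p : {additive U -> Q1}) (j : {additive U -> Q}) :
    (forall q, exists u, p u = q) ->
    (forall u, j u = 0 <-> p u = 0) ->
    (forall q : Q, q \in @multiples_pred d Q <-> exists u, j u = q) ->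
  isomorphic (multiples d Q) Q1.
Proof.
move=> p_surj ker_eq im_j.
have lift q : {u | j u = \val (q : multiples d Q)}.
  by apply/cid/im_j/valP.
pose f q := p (sval (lift q)).
have p_eq u v : j u = j v <-> p u = p v.
  split=> /eqP; rewrite -subr_eq0 -raddfB => /eqP/ker_eq/eqP;
  by rewrite raddfB subr_eq0 => /eqP.
have fB : zmod_morphism f.
  move=> a b; rewrite /f; case: (lift a) (lift b) (lift (a - b)) => /= u ju.
  move=> [v jv] [w jw] /=.
  by rewrite -raddfB; apply/p_eq; rewrite jw !raddfB /= ju jv.
pose fA : {additive multiples d Q -> Q1} :=
  HB.pack f (GRing.isZmodMorphism.Build _ _ f fB).
exists fA; apply: inj_surj_bijective => [a b|q1].
  rewrite /fA /= /f; case: (lift a) (lift b) => /= u ju [v jv] /= /p_eq.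
  by rewrite ju jv => /val_inj.
have [u pu] := p_surj q1.
have ju_mul : j u \in @multiples_pred d Q by apply/im_j; exists u.
exists (Subgroup ju_mul : multiples d Q); rewrite /fA /= /f.
by case: (lift _) => /= v /p_eq ->.
Qed.

Variables (V V1 : zmodType) (A B : zmodClosed V) (A1 B1 : zmodClosed V1).

(** The hypotheses say that [psi] induces an injective map on the quotients whose image is the group
    of multiples of [d]. *)
Lemma multiples_subquotient_isomorphic (d : nat) (psi : {additive V1 -> V}) :
    {in A1, forall a, psi a \in A} ->
    {in A1, forall a, psi a \in B <-> a \in B1} ->
    {in A, forall a, exists2 a1, a1 \in A1 & psi a1 - a *+ d \in B} ->
    {in A1, forall a1, exists2 a, a \in A & psi a1 - a *+ d \in B} ->
  isomorphic (multiples d (subquotient A B)) (subquotient A1 B1).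
Proof.
move=> psiA psiB AtoA1 A1toA.
have pi_eq0 (W : zmodType) (C D : zmodClosed W) (c : subgroup C) :
    \pi_(subquotient C D) c = 0 <-> val c \in D.
  rewrite -(raddf0 (\pi_(subquotient C D))).
  split=> [/eqP|cD]; [|apply/eqP]; rewrite -Quotient.idealrBE subr0 //.
pose psiS (a : subgroup A1) : subgroup A := Subgroup (psiA _ (valP a)).
pose j (a : subgroup A1) := \pi_(subquotient A B) (psiS a).
have jB : zmod_morphism j.
  move=> a b; rewrite /j -[RHS]raddfB; congr (\pi _).
  by apply: val_inj; rewrite /= !raddfB.
pose jA : {additive subgroup A1 -> subquotient A B} :=
  HB.pack j (GRing.isZmodMorphism.Build _ _ j jB).
pose p : {additive subgroup A1 -> subquotient A1 B1} := \pi_(subquotient A1 B1).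
apply: (@multiples_isomorphic _ _ _ _ p jA) => [q|u|q].
- by exists (repr q); apply: reprK.
- by rewrite [p u = 0]pi_eq0 [jA u = 0]pi_eq0 /=; apply/psiB/valP.
have pi_eq (a : subgroup A1) (b : subgroup A) :
    j a = \pi_(subquotient A B) b *+ d <-> psi (val a) - val b *+ d \in B.
  rewrite -raddfMn -raddfMn -[psi _]/(val (psiS a)) -raddfB -pi_eq0 raddfB.
  by split=> /eqP; [rewrite -subr_eq0 | rewrite subr_eq0] => /eqP.
rewrite inE; split=> [/asboolP[h ->]|[u <-]].
  rewrite -[h]reprK; have [a1 a1A1 a1B] := AtoA1 _ (valP (repr h)).
  by exists (Subgroup a1A1); apply/pi_eq.
apply/asboolP; have [a aA aB] := A1toA _ (valP u).
by exists (\pi_(subquotient A B) (Subgroup aA)); apply/pi_eq.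
Qed.

(* Modulo B, multiplication by d agrees with phi, and phi factors as psi \o    *)
(* sigma; the retraction rho makes the image of psi saturated, so that an      *)
(* element of psi A1 lying in B already lies in psi B1.                        *)
Lemma multiples_coker_isomorphic (d : nat) (M : zmodClosed V)
    (M1 : zmodClosed V1) (psi : {additive V1 -> V}) (phi : {additive V -> V})
    (phi1 : {additive V1 -> V1}) (sigma rho : {additive V -> V1}) :
    (forall v : V, v *+ d = 0 -> v = 0) ->
    {subset A <= M} -> {subset A1 <= M1} ->
    (forall b, b \in B <-> exists2 m, m \in M & b = m *+ d - phi m) ->
    (forall b, b \in B1 <-> exists2 m, m \in M1 & b = m *+ d - phi1 m) ->
    {in M, forall m, phi m = psi (sigma m)} ->
    {in M1, forall m, phi (psi m) = psi (phi1 m)} ->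
    {in M1, cancel psi rho} ->
    {in M1, forall m, psi m \in M} -> {in A1, forall m, psi m \in A} ->
    {in M, forall m, sigma m \in M1} -> {in A, forall m, sigma m \in A1} ->
    {in M, forall m, rho m \in M1} -> {in M1, forall m, phi1 m \in M1} ->
    {in A1, forall a, exists2 m, m \in A & psi a = phi m} ->
  isomorphic (multiples d (subquotient A B)) (subquotient A1 B1).
Proof.
move=> tf AM A1M1 BE B1E phiE phi_psi psiK psiM psiA sigM sigA rhoM phi1M im_psi.
apply: (@multiples_subquotient_isomorphic d psi) => // [a aA1|a aA|a aA1].
- split=> [|/B1E[m mM1 ->]]; last first.
    apply/BE; exists (psi m); first exact: psiM.
    by rewrite raddfB raddfMn /= phi_psi.
  move=> /BE[m mM psi_a]; apply/B1E; have aM1 := A1M1 _ aA1.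
  have dm : m *+ d = psi (a + sigma m) by rewrite raddfD psi_a /= -phiE // subrK.
  have rhoE : rho m *+ d = a + sigma m.
    by rewrite -raddfMn dm psiK ?rpredD // sigM.
  (* The two sides agree after multiplication by [d], and [V] has no [d]-torsion. *)
  have m_psi : m = psi (rho m).
    apply/eqP; rewrite -subr_eq0; apply/eqP/tf.
    by rewrite mulrnBl dm -raddfMn /= rhoE subrr.
  exists (rho m); first exact: rhoM.
  rewrite -[LHS]psiK // psi_a m_psi phi_psi ?rhoM // -raddfMn -raddfB /=.
  by rewrite psiK -?m_psi // rpredB ?rpredMn ?phi1M ?rhoM.
- exists (sigma a); first exact: sigA.
  by rewrite -phiE ?AM // -rpredN opprB; apply/BE; exists a => //; apply: AM.
have [m mA psi_a] := im_psi _ aA1; exists m => //.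
by rewrite -rpredN opprB psi_a; apply/BE; exists m => //; apply: AM.
Qed.

End MultiplesOfSubquotients.

(** * Additive maps on the cyclic algebra, and blocks of consecutive powers *)

Section CyclicAlgebra.
Local Open Scope ring_scope.

Lemma Zspan_ind (V : zmodType) (m : nat) (s : m.-tuple V) (P : V -> Prop) :
    P 0 -> (forall u v, P u -> P v -> P (u - v)) -> (forall i, P (tnth s i)) ->
  forall v, v \in Zspan s -> P v.
Proof.
move=> P0 PB Ps v; rewrite inE => /asboolP[a ->].
have PN u : P u -> P (- u) by move=> Pu; rewrite -sub0r; apply: PB.
have PD u w : P u -> P w -> P (u + w).
  by move=> Pu Pw; rewrite -[w]opprK; apply/PB/PN.
elim/big_ind: _ => // i _; rewrite -tnth_nth.
case: (a i) => k; rewrite ?NegzE ?mulrNz; [|apply: PN];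
by rewrite -pmulrn; elim: {a}k => [|k IHk]; rewrite ?mulr0n // mulrS; apply: PD.
Qed.

Lemma Zspan_coker (V : zmodType) (m : nat) (s t : m.-tuple V) (d : nat)
    (phi : {additive V -> V}) :
    (forall i, tnth t i = tnth s i *+ d - phi (tnth s i)) ->
  forall b, b \in Zspan t <-> exists2 a, a \in Zspan s & b = a *+ d - phi a.
Proof.
move=> tE b.
have TB u v : (u - v) *+ d - phi (u - v) = u *+ d - phi u - (v *+ d - phi v).
  by rewrite mulrnBl raddfB !opprD addrACA.
split=> [|[a]].
  apply: (@Zspan_ind _ _ _
    (fun b => exists2 a, a \in Zspan s & b = a *+ d - phi a)) => [|u1 v1|i].
  - by exists 0; rewrite ?rpred0 // raddf0 mul0rn subrr.
  - by case=> u us -> [v vs ->]; exists (u - v); rewrite ?rpredB.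
  by exists (tnth s i); rewrite ?tE // mem_Zspan ?mem_tnth.
move=> as_ ->; move: a as_.
apply: (@Zspan_ind _ _ _ (fun a => a *+ d - phi a \in Zspan t)) => [|u v|i].
- by rewrite raddf0 mul0rn subrr rpred0.
- by rewrite TB; apply: rpredB.
by rewrite -tE mem_Zspan ?mem_tnth.
Qed.

Definition group_ring (N : nat) : {pred cyclic_algebra N} :=
  Zspan [tuple xgen N ^+ i | i < N].

#[global] Arguments group_ring : clear implicits.

HB.instance Definition _ N := GRing.ZmodClosed.on (group_ring N).

(* The linear map sending xgen N ^+ j to h j for j < N. *)
Definition lift_powers (N N' : nat) (h : nat -> cyclic_algebra N')
    (a : cyclic_algebra N) : cyclic_algebra N' :=
  \sum_(j < N) in_qpoly ('X^N' - 1) ((polyn a)`_j)%:P * h j.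

Fact lift_powers_zmod_morphism N N' h : zmod_morphism (@lift_powers N N' h).
Proof.
move=> a b; rewrite /lift_powers -sumrB; apply: eq_bigr => j _.
by rewrite raddfB /= coefB raddfB raddfB /= mulrBl.
Qed.

HB.instance Definition _ N N' h := GRing.isZmodMorphism.Build _ _
  (@lift_powers N N' h) (@lift_powers_zmod_morphism N N' h).

Lemma cyclic_algebra_mulrn_eq0 N k (a : cyclic_algebra N) :
  (0 < k)%N -> a *+ k = 0 -> a = 0.
Proof.
move=> k_gt0 ak0; apply: val_inj; apply/polyP => i /=; rewrite coef0.
move/(congr1 (fun b : cyclic_algebra N => (polyn b)`_i)): ak0.
rewrite raddfMn /= coefMn coef0 => /eqP; rewrite mulrn_eq0.
by rewrite eqn0Ngt k_gt0 => /eqP.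
Qed.

Variable N : nat.

Definition block (k v : nat) : cyclic_algebra N :=
  \sum_(0 <= i < k) xgen N ^+ (k * v + i).

Lemma blockE k v : block k v = xgen N ^+ (k * v) * \sum_(i < k) xgen N ^+ i.
Proof.
by rewrite /block big_mkord mulr_sumr; apply: eq_bigr => i _; rewrite exprD.
Qed.

(** Consecutive blocks tile an interval of exponents; this makes block dilations compose by
    multiplying their factors. *)
Lemma block_block a b v :
  \sum_(0 <= i < b) block a (b * v + i) = block (a * b) v.
Proof.
rewrite /block (mulnC a b) big_nat_mul; apply: eq_bigr => i _.
rewrite mulSn -{1}[(i * a)%N]add0n big_addn addnK; apply: eq_bigr => j _.
by congr (_ ^+ _); lia.
Qed.

Hypothesis N_gt0 : (0 < N)%N.

Lemma polyn_xgenX v : (v < N)%N -> polyn (xgen N ^+ v) = 'X^v.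
Proof.
move=> vN; rewrite /xgen /qpolyX -rmorphXn in_qpoly_small //.
by rewrite /mk_monic size_XnsubC // ltnS N_gt0 monicXnsubC //
  size_XnsubC // size_polyXn.
Qed.

Lemma lift_powersX N' (h : nat -> cyclic_algebra N') v :
  lift_powers h (xgen N ^+ v) = h (v %% N)%N.
Proof.
have vN : (v %% N < N)%N by rewrite ltn_mod.
rewrite xgen_modn // /lift_powers (bigD1 (Ordinal vN)) //= polyn_xgenX //.
rewrite coefXn eqxx rmorph1 mul1r big1 ?addr0 // => j /negPf jv.
by rewrite coefXn -(inj_eq val_inj) /= in jv *; rewrite jv !raddf0 mul0r.
Qed.

Lemma lift_powersX_periodic N' (h : nat -> cyclic_algebra N') v :
  (forall j, h (j + N)%N = h j) -> lift_powers h (xgen N ^+ v) = h v.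
Proof.
move=> hN; rewrite lift_powersX [in RHS](divn_eq v N) addnC.
by elim: (v %/ N)%N => [|q IHq]; rewrite ?addn0 // mulSn addnCA addnC hN.
Qed.

Lemma xgen_dvdn k : (N %| k)%N -> xgen N ^+ k = 1.
Proof. by move=> Nk; rewrite xgen_modn // (eqP Nk). Qed.

Lemma xgenX_group_ring v : xgen N ^+ v \in group_ring N.
Proof.
rewrite xgen_modn //; have vN : (v %% N < N)%N by rewrite ltn_mod.
apply: mem_Zspan; apply/tnthP; exists (Ordinal vN).
by rewrite tnth_mktuple.
Qed.

Lemma calZ_group_ring : {subset calZ N <= group_ring N}.
Proof.
apply: (@Zspan_ind _ _ _ (fun z => z \in group_ring N)) => [|u v|i].
- exact: rpred0.
- exact: rpredB.
by rewrite tnth_mktuple /e_ -[1](expr0 (xgen N)) rpredB // xgenX_group_ring.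
Qed.

Section GroupRingInduction.
Variables (W : zmodType) (C : zmodClosed W).
Variables f f' : {additive cyclic_algebra N -> W}.

Lemma eq_on_group_ring : (forall v, f (xgen N ^+ v) = f' (xgen N ^+ v)) ->
  {in group_ring N, f =1 f'}.
Proof.
move=> ff'; apply: (@Zspan_ind _ _ _ (fun z => f z = f' z)) => [|u v fu fv|i].
- by rewrite !raddf0.
- by rewrite !raddfB /= fu fv.
by rewrite tnth_mktuple.
Qed.

Lemma group_ring_stable : (forall v, f (xgen N ^+ v) \in C) ->
  {in group_ring N, forall a, f a \in C}.
Proof.
move=> fC; apply: (@Zspan_ind _ _ _ (fun z => f z \in C)) => [|u v fu fv|i].
- by rewrite raddf0 rpred0.
- by rewrite raddfB rpredB.
by rewrite tnth_mktuple.
Qed.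

Lemma calZ_stable : (forall v, f (e_ N v) \in C) ->
  {in calZ N, forall a, f a \in C}.
Proof.
move=> fC; apply: (@Zspan_ind _ _ _ (fun z => f z \in C)) => [|u v fu fv|i].
- by rewrite raddf0 rpred0.
- by rewrite raddfB rpredB.
by rewrite tnth_mktuple.
Qed.

End GroupRingInduction.

Lemma block_group_ring k v : block k v \in group_ring N.
Proof. by apply: rpred_sum => i _; apply: xgenX_group_ring. Qed.

Lemma block_sub_calZ k v : block k v - block k 0 \in calZ N.
Proof.
rewrite /block -sumrB; apply: rpred_sum => i _.
have -> u w : xgen N ^+ u - xgen N ^+ w = e_ N u - e_ N w.
  by rewrite /e_ opprB addrA subrK.
by rewrite rpredB // e_in_calZ.
Qed.

End CyclicAlgebra.

(** * Dilations and block dilations *)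

Section PowerMaps.
Local Open Scope ring_scope.

Definition dilation N N' k := @lift_powers N N' (fun j => xgen N' ^+ (k * j)).

(** This is [dilation] followed by multiplication by 1 + ... + x^(k-1). As x^k - 1 is x - 1 times
    that sum, x - 1 times the block dilation of c is the dilation of (x - 1) c, for positive moduli
    with N' dividing k N. *)
Definition block_dilation N N' k := @lift_powers N N' (block N' k).

HB.instance Definition _ N N' k := GRing.Additive.on (@dilation N N' k).
HB.instance Definition _ N N' k := GRing.Additive.on (@block_dilation N N' k).

Variables N N' : nat.
Hypotheses (N_gt0 : (0 < N)%N) (N'_gt0 : (0 < N')%N).

Lemma dilationX k v : (N' %| k * N)%N ->
  dilation N' k (xgen N ^+ v) = xgen N' ^+ (k * v).
Proof.
move=> N'k; rewrite /dilation lift_powersX_periodic // => j.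
by rewrite mulnDr exprD [X in _ * X]xgen_dvdn // mulr1.
Qed.

Lemma dilation_e k v : (N' %| k * N)%N -> dilation N' k (e_ N v) = e_ N' (k * v).
Proof.
move=> N'k; rewrite /e_ -[1 in LHS](expr0 (xgen N)) raddfB /= !dilationX //.
by rewrite muln0.
Qed.

Lemma block_dilationX k v : (N' %| k * N)%N ->
  block_dilation N' k (xgen N ^+ v) = block N' k v.
Proof.
move=> N'k; rewrite /block_dilation lift_powersX_periodic // => j.
by rewrite !blockE mulnDr exprD [X in _ * X * _]xgen_dvdn // mulr1.
Qed.

Lemma block_dilation_e k v : (N' %| k * N)%N ->
  block_dilation N' k (e_ N v) = block N' k v - block N' k 0.
Proof.
by move=> N'k; rewrite /e_ -[1](expr0 (xgen N)) raddfB /= !block_dilationX.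
Qed.

Lemma block_dilation_block k l v : (N' %| k * N)%N ->
  block_dilation N' k (block N l v) = block N' (k * l) v.
Proof.
move=> N'k; rewrite {1}/block raddf_sum -[RHS]block_block.
by apply: eq_bigr => i _ /=; rewrite block_dilationX.
Qed.

(* The norm element 1 + x + ... + x ^+ N.-1 kills every e_ N v. *)
Lemma block_sub_add_mul k t v :
  block N (k + N * t) v - block N (k + N * t) 0 = block N k v - block N k 0.
Proof.
rewrite !blockE !muln0 !expr0 -!mulrBl mulnDl exprD.
rewrite [X in _ * X - 1]xgen_dvdn -?mulnA ?dvdn_mulr // mulr1.
(* The factor x - 1 of x^(kv) - 1 is moved to the other geometric sum, whose length then matters
   only modulo [N]. *)
rewrite (subrX1 _ (k * v)) mulrAC [RHS]mulrAC -!subrX1 exprD.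
by rewrite [X in _ * X - 1]xgen_dvdn ?dvdn_mulr // mulr1.
Qed.

End PowerMaps.

(** * The relation groups as images of d - phi *)

Section Relations.
Local Open Scope ring_scope.

Variables N d : nat.
Hypothesis N_gt0 : (0 < N)%N.

Lemma calE_coker b : b \in calE N d <->
  exists2 m, m \in calZ N & b = m *+ d - dilation N d m.
Proof.
apply: Zspan_coker => i; rewrite !tnth_mktuple /eps mulr_natl.
by rewrite /= dilation_e // dvdn_mull.
Qed.

Lemma f_E v : f_ N d v = xgen N ^+ v *+ d - block_dilation N d (xgen N ^+ v).
Proof. by rewrite block_dilationX ?dvdn_mull // /f_ mulr_natl. Qed.

(* The graph is d-in-regular, so the columns of its Laplacian sum to zero. *)
Lemma f_0_calF : f_ N d 0 \in calF N d.
Proof.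
have sum_f : \sum_(0 <= v < N) f_ N d v = 0.
  rewrite sumrB -mulr_sumr -[X in _ - X]/(\sum_(0 <= v < N) block N d v).
  (* The [N] blocks of length [d] cover the exponents below d N, which regroup into [d] full
     periods. *)
  have := @block_block N d N 0.
  under eq_bigr => v _ do rewrite muln0 add0n.
  move=> ->; rewrite mulnC -block_block.
  under [X in _ - X]eq_bigr => v _ do
    rewrite muln0 add0n blockE xgen_dvdn ?dvdn_mulr // mul1r.
  by rewrite sumr_const_nat subn0 big_mkord mulr_natl subrr.
have := sum_f; rewrite big_ltn // => /eqP; rewrite addr_eq0 => /eqP ->.
rewrite rpredN big_add1 big_mkord; apply: rpred_sum => i _.
by apply: mem_Zspan; apply/tnthP; exists i; rewrite tnth_mktuple.
Qed.

Lemma f_calF v : (v < N)%N -> f_ N d v \in calF N d.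
Proof.
case: v => [_|v vN]; first exact: f_0_calF.
have vN' : (v < N.-1)%N by rewrite -ltnS prednK.
by apply: mem_Zspan; apply/tnthP; exists (Ordinal vN'); rewrite tnth_mktuple.
Qed.

(** By [f_0_calF], adding [f_ N d 0] to the generators leaves their span unchanged; they are then
    indexed by the whole basis of [group_ring N]. *)
Lemma calF_coker b : b \in calF N d <->
  exists2 m, m \in group_ring N & b = m *+ d - block_dilation N d m.
Proof.
rewrite -(@Zspan_coker _ _ _ [tuple f_ N d i | i < N]); last first.
  by move=> i; rewrite !tnth_mktuple f_E.
split; apply: (@Zspan_ind _ _ _ (fun b => b \in _)) => [|u v|i].
- exact: rpred0.
- exact: rpredB.
- rewrite tnth_mktuple; apply: mem_Zspan; apply/tnthP.
  have iN : (i.+1 < N)%N by have := ltn_ord i; lia.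
  by exists (Ordinal iN); rewrite tnth_mktuple.
- exact: rpred0.
- exact: rpredB.
by rewrite tnth_mktuple f_calF.
Qed.

End Relations.

(** * The two isomorphisms *)

Section MultiplesOfSigmaAndSandpile.
Local Open Scope ring_scope.

Variables n d : nat.
Hypotheses (n_gt0 : (0 < n)%N) (d_gt0 : (0 < d)%N).

Let g := gcdn n d.
Let n1 := (n %/ g)%N.
Let d1 := (d %/ g)%N.

Let g_gt0 : (0 < g)%N. Proof. by rewrite gcdn_gt0 n_gt0. Qed.
Let nE : n = (g * n1)%N. Proof. by rewrite mulnC divnK ?dvdn_gcdl. Qed.
Let dE : d = (g * d1)%N. Proof. by rewrite mulnC divnK ?dvdn_gcdr. Qed.
Let n1_gt0 : (0 < n1)%N.
Proof. by move: n_gt0; rewrite nE muln_gt0 => /andP[]. Qed.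
Let dvd_mul k N : (N %| k * N)%N. Proof. exact: dvdn_mull. Qed.
Let dvd_psi : (n %| g * n1)%N. Proof. by rewrite nE. Qed.
Let dvd_sigma : (n1 %| d1 * n)%N. Proof. by rewrite nE mulnA dvdn_mull. Qed.

Let bezout : exists k t, (d * k = g + n * t)%N.
Proof.
case: (egcdnP n d_gt0) => k t dkE _; exists k, t.
by rewrite mulnC dkE addnC mulnC gcdnC.
Qed.

Lemma multiples_Sigma : isomorphic (multiples d (Sigma n d)) (Sigma n1 d).
Proof.
(* Flooring, instead of killing the powers not divisible by g, makes rho       *)
(* preserve calZ.                                                              *)
pose rho := @lift_powers n n1 (fun j => xgen n1 ^+ (j %/ g)).
apply: (@multiples_coker_isomorphic _ _ _ _ _ _ d (calZ n) (calZ n1)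
  (dilation n g) (dilation n d) (dilation n1 d) (dilation n1 d1) rho) => //.
- by move=> v; apply: cyclic_algebra_mulrn_eq0.
- by move=> b; apply: calE_coker.
- by move=> b; apply: calE_coker.
- move=> m /(calZ_group_ring n_gt0).
  apply: (eq_on_group_ring (f' := dilation n g \o dilation n1 d1)) => v /=.
  by rewrite !dilationX // mulnA -dE.
- move=> m /(calZ_group_ring n1_gt0).
  apply: (eq_on_group_ring (f := dilation n d \o dilation n g)
    (f' := dilation n g \o dilation n1 d)) => v /=.
  by rewrite !dilationX // mulnCA.
- move=> m /(calZ_group_ring n1_gt0).
  apply: (eq_on_group_ring (f := rho \o dilation n g) (f' := idfun)) => v /=.
  by rewrite dilationX // lift_powersX // {1}nE -muln_modr mulKn // -xgen_modn.
- by apply: calZ_stable => v; rewrite /= dilation_e // e_in_calZ.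
- by apply: calZ_stable => v; rewrite /= dilation_e // e_in_calZ.
- by apply: calZ_stable => v; rewrite /= dilation_e // e_in_calZ.
- by apply: calZ_stable => v; rewrite /= dilation_e // e_in_calZ.
- apply: calZ_stable => v.
  rewrite /e_ -[1](expr0 (xgen n)) raddfB /= !lift_powersX // mod0n div0n.
  exact: e_in_calZ.
- by apply: calZ_stable => v; rewrite /= dilation_e // e_in_calZ.
apply: (@Zspan_ind _ _ _
  (fun a => exists2 m, m \in calZ n & dilation n g a = dilation n d m)).
- by exists 0; rewrite ?rpred0 // !raddf0.
- move=> u v [a aZ ua] [b bZ vb]; exists (a - b); first exact: rpredB.
  by rewrite !raddfB /= ua vb.
(* As d k is g modulo n, dilating by [d] the generator of index k v gives the dilation by [g] of the
   one of index v. *)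
move=> i; rewrite tnth_mktuple; have [k [t kt]] := bezout.
exists (e_ n (k * i.+1)); first exact: e_in_calZ.
rewrite !dilation_e // mulnA kt mulnDl /e_ exprD.
by rewrite [X in _ * X - 1]xgen_dvdn ?mulr1 // -mulnA dvdn_mulr.
Qed.

Lemma multiples_Sandpile :
  isomorphic (multiples d (Sandpile n d)) (Sandpile n1 d).
Proof.
(* A block of length [g] starting at g v has one exponent divisible by [g], so killing the others
   recovers y^v, where flooring would give g y^v. Here [rho] need only preserve the group ring. *)
pose rho := @lift_powers n n1
  (fun j => if (g %| j)%N then xgen n1 ^+ (j %/ g) else 0).
apply: (@multiples_coker_isomorphic _ _ _ _ _ _ d (group_ring n) (group_ring n1)
  (block_dilation n g) (block_dilation n d) (block_dilation n1 d)
  (block_dilation n1 d1) rho).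
- by move=> v; apply: cyclic_algebra_mulrn_eq0.
- exact: calZ_group_ring.
- exact: calZ_group_ring.
- by move=> b; apply: calF_coker.
- by move=> b; apply: calF_coker.
- apply: (eq_on_group_ring
    (f' := block_dilation n g \o block_dilation n1 d1)) => v /=.
  by rewrite !block_dilationX // block_dilation_block // -dE.
- apply: (eq_on_group_ring (f := block_dilation n d \o block_dilation n g)
    (f' := block_dilation n g \o block_dilation n1 d)) => v /=.
  by rewrite !block_dilationX // !block_dilation_block // mulnC.
- apply: (eq_on_group_ring (f := rho \o block_dilation n g) (f' := idfun)) => v /=.
  (* With v reduced below [n1], the exponents g v + i stay below [n] and do not wrap around. *)
  rewrite xgen_modn // block_dilationX //.
  have vn1 : (v %% n1 < n1)%N by rewrite ltn_mod.
  move: (v %% n1)%N vn1 => {}v vn1.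
  have -> : block n g v = \sum_(i < g) xgen n ^+ (g * v + i).
    by rewrite /block big_mkord.
  rewrite raddf_sum (bigD1 (Ordinal g_gt0)) //= big1 ?addr0; last first.
    move=> i i_neq0; rewrite /rho lift_powersX // modn_small.
      by rewrite dvdn_addr ?dvdn_mulr // gtnNdvd // lt0n.
    by rewrite nE; have := ltn_ord i; nia.
  rewrite /rho lift_powersX // addn0 modn_small ?dvdn_mulr ?mulKn //.
  by rewrite nE ltn_pmul2l.
- by apply: group_ring_stable => v; rewrite /= block_dilationX // block_group_ring.
- by apply: calZ_stable => v; rewrite /= block_dilation_e // block_sub_calZ.
- by apply: group_ring_stable => v; rewrite /= block_dilationX // block_group_ring.
- by apply: calZ_stable => v; rewrite /= block_dilation_e // block_sub_calZ.
- apply: group_ring_stable => v; rewrite /= /rho lift_powersX //.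
  by case: ifP => _; rewrite ?rpred0 // xgenX_group_ring.
- apply: group_ring_stable => v.
  by rewrite /= block_dilationX // block_group_ring.
apply: (@Zspan_ind _ _ _ (fun a =>
  exists2 m, m \in calZ n & block_dilation n g a = block_dilation n d m)).
- by exists 0; rewrite ?rpred0 // !raddf0.
- move=> u v [a aZ ua] [b bZ vb]; exists (a - b); first exact: rpredB.
  by rewrite !raddfB /= ua vb.
move=> i; rewrite tnth_mktuple; have [k [t kt]] := bezout.
(* Block dilation by [d] turns length [k] into d k = g + n t. The n t extra terms are full periods,
   which cancel in the difference. *)
exists (block n k i.+1 - block n k 0); first exact: block_sub_calZ.
rewrite block_dilation_e // raddfB /= !block_dilation_block //.
by rewrite kt block_sub_add_mul.
Qed.

End MultiplesOfSigmaAndSandpile.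

Theorem theorem4p1 (n d : nat) (n_ge1 : 1 <= n) (d_ge2 : 2 <= d) :
  let n1 := n %/ gcdn n d in
  isomorphic (multiples d (Sigma n d)) (Sigma n1 d) /\
  isomorphic (multiples d (Sandpile n d)) (Sandpile n1 d).
Proof.
have d_gt0 := ltnW d_ge2.
by split; [apply: multiples_Sigma | apply: multiples_Sandpile].
Qed.
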